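(* Let $b \ge 2$ be an integer and let $\rho, \sigma$ be positive integers. If $\sigma$ divides $\rho$, then every real number whose $b^\rho$-ary expansion is quasi-Sturmian has a quasi-Sturmian $b^\sigma$-ary expansion. Moreover (for arbitrary positive integers $\rho, \sigma$), every real number whose $b^\rho$-ary and $b^\sigma$-ary expansions are both quasi-Sturmian has a quasi-Sturmian $b^\mu$-ary expansion, where $\mu$ is the least common multiple of $\rho$ and $\sigma$.
   Context: For an integer $B \ge 2$ and a real number $\xi$, write $\xi = \lfloor \xi \rfloor + \sum_{k \ge 1} a_k B^{-k}$, where each $a_k \in \{0, 1, \ldots, B-1\}$ and infinitely many $a_k$ are not equal to $B-1$. The sequence $(a_k)_{k\ge 1}$ is uniquely determined; it is called the $B$-ary expansion of $\xi$ and is viewed as the infinite word $a_1 a_2 \ldots$ over $\{0, 1, \ldots, B-1\}$. For an infinite word $\mathbf x = x_1 x_2 \ldots$ over a finite alphabet and a positive integer $n$, $p(n, \mathbf x) := \mathrm{Card}\{x_{j+1} \ldots x_{j+n} : j \ge 0\}$. An infinite word $\mathbf x$ is quasi-Sturmian if there are positive integers $k$ and $n_0$ such that $p(n, \mathbf x) = n + k$ for all $n \ge n_0$. *)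

(* Defs.v *)
From HB Require Import structures.
From mathcomp Require Import all_boot all_order all_algebra.
From mathcomp Require Import all_classical all_reals all_analysis.

Set Implicit Arguments.
Unset Strict Implicit.
Unset Printing Implicit Defensive.

Import Order.TTheory GRing.Theory Num.Theory.
Import numFieldNormedType.Exports.

Local Open Scope classical_set_scope.
Local Open Scope ring_scope.

(* An infinite word x_1 x_2 ... is a function [x : nat -> T], where [x j] is
   the letter x_(j+1); thus [factor x n j] is x_(j+1) ... x_(j+n). *)
Definition factor (T : finType) (x : nat -> T) (n j : nat) : n.-tuple T :=
  [tuple x (j + i)%N | i < n].

Definition complexity (T : finType) (x : nat -> T) (n : nat) : nat :=
  #|[set w : n.-tuple T | `[< exists j : nat, w = factor x n j >]]%SET|.

Definition quasi_sturmian (T : finType) (x : nat -> T) : Prop :=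
  exists k n0 : nat, [/\ (0 < k)%N, (0 < n0)%N &
    forall n : nat, (n0 <= n)%N -> complexity x n = (n + k)%N].

(* With the same shift of indices, the digit [a k] is weighted by B^-(k+1).
   The digit sequence satisfying this predicate exists and is unique
   for 2 <= B. *)
Definition is_expansion (R : realType) (B : nat) (xi : R) (a : nat -> 'I_B) :
    Prop :=
  series (fun k : nat => (a k)%:R / B%:R ^+ k.+1 : R) @ \oo
    --> xi - (Num.floor xi)%:~R /\
  infinite_set [set k : nat | (a k : nat) <> B.-1].

Definition has_quasi_sturmian_expansion (R : realType) (B : nat) (xi : R) :
    Prop :=
  exists2 a : nat -> 'I_B, is_expansion xi a & quasi_sturmian a.

(* Main.v *)
Require Import Defs.
From mathcomp Require Import all_boot all_order all_algebra.
From mathcomp Require Import all_classical all_reals all_analysis.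
From mathcomp Require Import zify ring lra.
(* Imported last, so that [factor] denotes a factor of a word and not the affine
   map of the same name. *)
Import Defs.

Set Implicit Arguments.
Unset Strict Implicit.
Unset Printing Implicit Defensive.

Import Order.TTheory GRing.Theory Num.Theory.
Import numFieldNormedType.Exports.

(** A word that is not eventually periodic has complexity at least [n + 1] by
    Morse and Hedlund, and its complexity minus [n] never decreases; hence being
    quasi-Sturmian means: not eventually periodic, and of complexity at most
    [n + C] for a constant [C] ([quasi_sturmian_bound],
    [quasi_sturmian_of_bound]). This turns both halves of the theorem into
    counting up to bounded errors.

    Let [c] be the base-[b] expansion of [xi]. Its base-[b ^ d] expansion is [c]
    cut into consecutive blocks of length [d], up to the coding of a block as a
    digit ([eq_expansion_block]). So the statement concerns only the words
    [block c d 0], whose factors of length [n] are the factors of [c] of length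
    [n * d] at positions divisible by [d].

    Descent to a divisor ([quasi_sturmian_unblock]). If [block c d 0] is
    quasi-Sturmian, each residue class mod [d] of positions carries at most
    [n + C] factors of length [n * d], because such a factor lies inside [n + 1]
    consecutive blocks. Summing over the [d] classes bounds the complexity of
    [c] at [n * d] by [n * d + C'].

    Ascent to the least common multiple ([quasi_sturmian_block_lcm]). The same
    sum exceeds the number of factors of [c] of length [L = n * d], which is at
    least [L + 1], by a bounded amount only. Hence all factors of length [L]
    but boundedly many occur at positions of a single class mod [d]. If this
    holds for [d] and for [e], then at lengths divisible by [m = lcmn d e] all
    factors but boundedly many determine their position mod [d] and mod [e],
    hence mod [m]; so the numbers of factors in the [m] classes mod [m] add up
    to at most [n * m + C']. Each class other than that of [0] contributes at
    least [n + 1], again by Morse and Hedlund, which leaves at most [n + C'] for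
    the class of [0], that is, for the complexity of [block c m 0]. *)

Section Combinatorics.
Local Open Scope nat_scope.

(** * Words, factors and complexity *)

Definition values (U : finType) (f : nat -> U) : {set U} :=
  [set w | `[< exists j, w = f j >]]%SET.

Lemma valuesP (U : finType) (f : nat -> U) w :
  reflect (exists j, w = f j) (w \in values f).
Proof. by rewrite inE; apply: asboolP. Qed.

Lemma mem_values (U : finType) (f : nat -> U) j : f j \in values f.
Proof. by apply/valuesP; exists j. Qed.

Lemma complexityE (T : finType) (x : nat -> T) n :
  complexity x n = #|values (factor x n)|.
Proof. by []. Qed.

(** The values of [f] are a function of those of [g]. As [U] and [V] may differ,
    this compares words over different alphabets without any explicit map between
    them. *)
Lemma leq_card_values (U V : finType) (f : nat -> U) (g : nat -> V) :
  (forall j j', g j = g j' -> f j = f j') -> #|values f| <= #|values g|.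
Proof.
move=> gf.
pose h (v : V) : U :=
  if pselect (exists j, v == g j) is left e then f (xchoose e) else f 0.
suff /subset_leq_card : values f \subset h @: values g.
  by move/leq_trans; apply; apply: leq_imset_card.
apply/fintype.subsetP => w /valuesP[j ->]; apply/imsetP; exists (g j).
  exact: mem_values.
rewrite /h; case: pselect => [e|[]]; last by exists j.
by apply: gf; rewrite -(eqP (xchooseP e)).
Qed.

Lemma eq_factor (T : finType) (x : nat -> T) n j j' :
  factor x n j = factor x n j' <-> forall i, i < n -> x (j + i) = x (j' + i).
Proof.
split=> [e i ltin|e]; last by apply: eq_mktuple => i; apply: e.
by have := congr1 (fun t => tnth t (Ordinal ltin)) e; rewrite !tnth_mktuple.
Qed.

(** Only the coincidences between letters matter, so the coding of blocks as
    digits never has to be written down. *)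
Lemma quasi_sturmian_ext (T U : finType) (x : nat -> T) (y : nat -> U) :
  (forall j j', x j = x j' <-> y j = y j') ->
  quasi_sturmian x -> quasi_sturmian y.
Proof.
move=> xy [k [n0 [k0 n0_gt0 qs]]]; exists k, n0; split=> // n le_n.
rewrite -qs //; apply/eqP; rewrite eqn_leq !leq_card_values //;
  by move=> j j' /eq_factor e; apply/eq_factor => i /e /xy.
Qed.

Lemma complexity0 (T : finType) (x : nat -> T) : complexity x 0 = 1.
Proof.
apply/eqP; rewrite complexityE eqn_leq; apply/andP; split.
  by apply: leq_trans (max_card _) _; rewrite card_tuple expn0.
by apply/card_gt0P; exists (factor x 0 0); apply: mem_values.
Qed.

(** * Complexity of aperiodic words *)

Definition eventually_periodic (T : Type) (x : nat -> T) : Prop :=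
  exists p N, 0 < p /\ forall j, N <= j -> x (j + p) = x j.

Lemma values_collision (U : finType) (f : nat -> U) :
  exists i j, i < j /\ f i = f j.
Proof.
apply: contrapT => nocol.
have inj : injective (fun i : 'I_#|U|.+1 => f i).
  move=> i j eij; apply: val_inj; case: (ltngtP i j) => // h; exfalso;
    apply: nocol.
    by exists i, j.
  by exists j, i.
by have := leq_card _ inj; rewrite card_ord ltnn.
Qed.

(** If the complexity does not increase from [n] to [n + 1], every factor of
    length [n] has a unique extension to the right, so a factor determines all
    that follows it. Some factor of length [n] occurs twice, and from there on
    the word repeats. *)
Lemma morse_hedlund (T : finType) (x : nat -> T) n :
  ~ eventually_periodic x -> complexity x n < complexity x n.+1.
Proof.
move=> nper; rewrite ltnNge; apply/negP => le_p; apply: nper.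
pose h (w : n.+1.-tuple T) : n.-tuple T :=
  [tuple tnth w (widen_ord (leqnSn n) i) | i < n].
have hE j : h (factor x n.+1 j) = factor x n j.
  by apply: eq_mktuple => i; rewrite tnth_mktuple.
have im : h @: values (factor x n.+1) = values (factor x n).
  apply/setP => w; apply/imsetP/valuesP => [[v /valuesP[j ->] ->]|[j ->]].
    by exists j; rewrite hE.
  by exists (factor x n.+1 j); rewrite ?hE ?mem_values.
have /imset_injP inj :
    #|h @: values (factor x n.+1)| == #|values (factor x n.+1)|.
  by rewrite eqn_leq leq_imset_card im.
have det j j' :
    factor x n j = factor x n j' -> factor x n.+1 j = factor x n.+1 j'.
  by rewrite -!hE; apply: inj; apply: mem_values.
have step j j' :
    factor x n j = factor x n j' -> factor x n j.+1 = factor x n j'.+1.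
  move/det/eq_factor => e; apply/eq_factor => i ltin.
  by rewrite !addSnnS; apply: e.
have [i [j [ltij e]]] := values_collision (factor x n).
have all_t t : factor x n (i + t) = factor x n (j + t).
  by elim: t => [|t IH]; rewrite ?addn0 // !addnS; apply: step.
exists (j - i), (i + n); split=> [|m le_m]; first by rewrite subn_gt0.
have /eq_factor/(_ n (ltnSn n)) := det _ _ (all_t (m - (i + n))).
have -> : i + (m - (i + n)) + n = m by lia.
by have -> : j + (m - (i + n)) + n = m + (j - i) by lia.
Qed.

Lemma complexity_gap (T : finType) (x : nat -> T) m n :
  ~ eventually_periodic x -> m <= n ->
  complexity x m + (n - m) <= complexity x n.
Proof.
move=> nper /subnKC <-; rewrite addKn; elim: (n - m) => [|t IH].
  by rewrite !addn0.
by rewrite !addnS; apply: leq_trans (morse_hedlund _ nper); rewrite ltnS.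
Qed.

Lemma complexity_gt (T : finType) (x : nat -> T) n :
  ~ eventually_periodic x -> n < complexity x n.
Proof.
move=> nper; have := complexity_gap nper (leq0n n).
by rewrite complexity0 subn0 add1n.
Qed.

(** A position beyond the preperiod can be moved back by the period without
    changing the factor that starts there. *)
Lemma eventually_periodic_bounded (T : finType) (x : nat -> T) :
  eventually_periodic x -> exists C, forall n, complexity x n <= C.
Proof.
move=> [p [N [p0 per]]]; exists (N + p) => n.
have red j : exists2 j', j' < N + p & factor x n j = factor x n j'.
  elim/ltn_ind: j => j IH; case: (ltnP j (N + p)) => [ltj|lej].
    by exists j.
  have [|j' ltj' e] := IH (j - p); first lia.
  exists j' => //; rewrite -e; apply/eq_factor => i _.
  rewrite -(per (j - p + i)); last lia.
  by congr (x _); lia.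
have /subset_leq_card : values (factor x n) \subset
    [set factor x n (j : 'I_(N + p)) | j in 'I_(N + p)]%SET.
  apply/fintype.subsetP => w /valuesP[j ->]; have [j' ltj' ->] := red j.
  by apply/imsetP; exists (Ordinal ltj').
by move/leq_trans; apply; rewrite (leq_trans (leq_imset_card _ _)) // card_ord.
Qed.

Lemma quasi_sturmian_aperiodic (T : finType) (x : nat -> T) :
  quasi_sturmian x -> ~ eventually_periodic x.
Proof.
move=> [k [n0 [_ _ qs]]] /eventually_periodic_bounded[C /(_ (n0 + C.+1))].
by rewrite qs ?leq_addr //; lia.
Qed.

Lemma quasi_sturmian_bound (T : finType) (x : nat -> T) :
  quasi_sturmian x -> exists C, forall n, complexity x n <= n + C.
Proof.
move=> qs; have nper := quasi_sturmian_aperiodic qs.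
case: qs => k [n0 [_ _ qs]]; exists (n0 + k) => n.
have := qs (n0 + n) (leq_addr _ _); have := complexity_gap nper (leq_addl n0 n).
lia.
Qed.

(** The complexity minus [n] is nondecreasing and bounded, hence eventually
    constant. A bound along the multiples of [d] is enough by monotonicity. *)
Lemma quasi_sturmian_of_bound (T : finType) (x : nat -> T) d C :
  ~ eventually_periodic x -> 0 < d ->
  (forall n, complexity x (n * d) <= n * d + C) -> quasi_sturmian x.
Proof.
move=> nper d0 bnd.
(* [P v] says that the excess of the complexity over the length takes the
   value [v]; the constant sought is the largest such [v]. *)
pose P v := `[< exists n, complexity x n = n + v >].
have exP : exists v, P v.
  by exists 1; apply/asboolP; exists 0; rewrite complexity0.
have maxP v : P v -> v <= C.
  move/asboolP=> [n en]; have := bnd n.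
  have := @complexity_gap _ x n (n * d) nper (leq_pmulr _ d0).
  by rewrite en; nia.
case: (ex_maxnP exP maxP) => k /asboolP[n1 en1] kmax.
exists k, n1.+1; split=> // [|n le_n].
  by have := complexity_gt n1 nper; rewrite en1; lia.
have gt_n := complexity_gt n nper.
have /kmax : P (complexity x n - n).
  by apply/asboolP; exists n; lia.
by have := complexity_gap nper (ltnW le_n); lia.
Qed.

(** * Cutting a word into blocks *)

Definition block (T : finType) (x : nat -> T) (d i : nat) : nat -> d.-tuple T :=
  fun j => factor x d (j * d + i).

Lemma eq_factor_block (T : finType) (x : nat -> T) d i n j j' :
  factor (block x d i) n j = factor (block x d i) n j' <->
  factor x (n * d) (j * d + i) = factor x (n * d) (j' * d + i).
Proof.
split=> /eq_factor e; apply/eq_factor => t ltt.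
  have d0 : 0 < d by move: ltt; case: (d) => //; rewrite muln0.
  have lt_q : t %/ d < n by rewrite ltn_divLR.
  have /eq_factor/(_ (t %% d)) := e _ lt_q; rewrite ltn_mod => /(_ d0).
  have split k : k * d + i + t = (k + t %/ d) * d + i + t %% d.
    by have := divn_eq t d; lia.
  by rewrite !split.
apply/eq_factor => s lts; rewrite !mulnDl.
have := e (t * d + s) _.
by rewrite ![_ + t * d + i]addnAC !addnA; apply; nia.
Qed.

Lemma complexity_block (T : finType) (x : nat -> T) d i n :
  complexity (block x d i) n =
  #|values (fun j => factor x (n * d) (j * d + i))|.
Proof.
by apply/eqP; rewrite eqn_leq !leq_card_values // => j j' /eq_factor_block.
Qed.

Lemma block_aperiodic (T : finType) (x : nat -> T) d i :
  0 < d -> ~ eventually_periodic x -> ~ eventually_periodic (block x d i).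
Proof.
move=> d0 nper [p [N [p0 per]]]; apply: nper.
exists (p * d), (N * d + i); split=> [|j lej]; first by rewrite muln_gt0 p0.
have := per ((j - i) %/ d); rewrite leq_divRL // leq_subRL; last by lia.
rewrite addnC => /(_ lej) /eq_factor/(_ ((j - i) %% d)).
rewrite ltn_mod => /(_ d0) e; have e2 := divn_eq (j - i) d.
have -> : j + p * d = ((j - i) %/ d + p) * d + i + (j - i) %% d by lia.
by rewrite e; congr (x _); lia.
Qed.

Lemma aperiodic_of_block (T : finType) (x : nat -> T) d i :
  ~ eventually_periodic (block x d i) -> ~ eventually_periodic x.
Proof.
move=> nper [p [N [p0 per]]]; apply: nper.
case: (posnP d) => [->|d0].
  by exists 1, 0; split=> // j _; apply/eq_factor.
have perm q j : N <= j -> x (j + q * p) = x j.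
  elim: q => [|q IH] lej; first by rewrite addn0.
  by rewrite mulSn addnCA addnC per ?IH // (leq_trans lej) ?leq_addr.
exists p, N; split=> // j lej; apply/eq_factor => t ltt.
rewrite -(perm d (j * d + i + t)); last by nia.
by congr (x _); lia.
Qed.

(** A factor of length [n * d] starting at offset [i < d] is contained in the
    [n + 1] consecutive blocks that start at offset [0]. *)
Lemma leq_residue_complexity (T : finType) (x : nat -> T) d i n :
  i < d -> complexity (block x d i) n <= complexity (block x d 0) n.+1.
Proof.
move=> ltid; apply: leq_card_values => j j' /eq_factor_block/eq_factor e.
apply/eq_factor_block/eq_factor => t ltt.
by have := e (i + t); rewrite !addn0 !addnA; apply; nia.
Qed.

(** * Factors and the residue classes of their positions *)

Definition residue_factors (T : finType) (x : nat -> T) L d i :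
    {set L.-tuple T} :=
  values (fun j => factor x L (j * d + i)).

Definition multiplicity (T : finType) (x : nat -> T) L d (w : L.-tuple T) :
    nat :=
  #|[set i : 'I_d | w \in residue_factors x L d i]|.

(** Double counting of the pairs of a factor and a class in which it occurs. *)
Lemma sum_residue_factors (T : finType) (x : nat -> T) L d :
  \sum_(i < d) #|residue_factors x L d i| =
  \sum_(w in values (factor x L)) multiplicity x d w.
Proof.
transitivity (\sum_(i < d) \sum_(w in residue_factors x L d i) 1).
  by apply: eq_bigr => i _; rewrite sum1_card.
rewrite (exchange_big_dep (mem (values (factor x L)))) /=; last first.
  by move=> i w _ /valuesP[j ->]; apply: mem_values.
apply: eq_bigr => w _; rewrite /multiplicity -sum1_card.
by apply: eq_bigl => i; rewrite inE.
Qed.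

Lemma mem_residue_factors (T : finType) (x : nat -> T) L d j :
  0 < d -> factor x L j \in residue_factors x L d (j %% d).
Proof. by move=> d0; apply/valuesP; exists (j %/ d); rewrite -divn_eq. Qed.

Lemma multiplicity_gt0 (T : finType) (x : nat -> T) L d w :
  0 < d -> w \in values (factor x L) -> 0 < multiplicity x d w.
Proof.
move=> d0 /valuesP[j ->]; apply/card_gt0P.
have ltj : j %% d < d by rewrite ltn_mod.
by exists (Ordinal ltj); rewrite inE mem_residue_factors.
Qed.

Lemma leq_sum_residue (T : finType) (x : nat -> T) L d :
  0 < d -> complexity x L <= \sum_(i < d) #|residue_factors x L d i|.
Proof.
move=> d0; rewrite sum_residue_factors complexityE -sum1_card.
by apply: leq_sum => w; apply: multiplicity_gt0.
Qed.

Lemma sum_residue_bound (T : finType) (x : nat -> T) d :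
  0 < d -> quasi_sturmian (block x d 0) ->
  exists C, forall n,
    \sum_(i < d) #|residue_factors x (n * d) d i| <= n * d + C.
Proof.
move=> d0 /quasi_sturmian_bound[C bnd]; exists (d * C.+1) => n.
apply: (@leq_trans (\sum_(i < d) (n + C.+1))).
  apply: leq_sum => i _; rewrite -complexity_block.
  apply: leq_trans (leq_residue_complexity _ _ (ltn_ord i)) _.
  by rewrite addnS -addSn.
by rewrite sum_nat_const card_ord; lia.
Qed.

Lemma quasi_sturmian_unblock (T : finType) (x : nat -> T) d :
  0 < d -> quasi_sturmian (block x d 0) -> quasi_sturmian x.
Proof.
move=> d0 qs; have [C bnd] := sum_residue_bound d0 qs.
apply: (@quasi_sturmian_of_bound _ _ d C) => // [|n].
  exact: aperiodic_of_block (quasi_sturmian_aperiodic qs).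
exact: leq_trans (leq_sum_residue _ _ d0) (bnd n).
Qed.

(** The factors that do not determine their position mod [d]. *)
Definition ambiguous (T : finType) (x : nat -> T) L d : {set L.-tuple T} :=
  [set w in values (factor x L) | 1 < multiplicity x d w]%SET.

(** Summing over the classes counts each factor at least once, and each
    ambiguous one at least twice. *)
Lemma card_ambiguous (T : finType) (x : nat -> T) L d :
  0 < d ->
  complexity x L + #|ambiguous x L d| <=
  \sum_(i < d) #|residue_factors x L d i|.
Proof.
move=> d0; rewrite sum_residue_factors complexityE -!sum1_card.
rewrite [X in _ + X](eq_bigl (fun w => (w \in values (factor x L)) &&
    (1 < multiplicity x d w))); last first.
  by move=> w; rewrite inE.
rewrite big_mkcondr -big_split /=; apply: leq_sum => w w_in.
by have := multiplicity_gt0 d0 w_in; case: (ltnP 1 (multiplicity x d w)).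
Qed.

Lemma unambiguous_residue (T : finType) (x : nat -> T) L d j j' :
  0 < d -> factor x L j = factor x L j' ->
  factor x L j \notin ambiguous x L d -> j = j' %[mod d].
Proof.
move=> d0 e; rewrite inE mem_values /= -leqNgt => /card_le1_eqP uniq.
have [ltj ltj'] : j %% d < d /\ j' %% d < d by rewrite !ltn_mod.
suff [] : Ordinal ltj = Ordinal ltj' by [].
by apply: uniq; rewrite inE /= ?mem_residue_factors // e mem_residue_factors.
Qed.

Lemma eqn_mod_lcm m n d e :
  (m == n %[mod lcmn d e]) = (m == n %[mod d]) && (m == n %[mod e]).
Proof.
wlog le_nm : m n / n <= m.
  move=> H; case/orP: (leq_total n m) => [|le_mn]; first exact: H.
  by rewrite ![m %% _ == _]eq_sym H.
by rewrite !eqn_mod_dvd // dvdn_lcm.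
Qed.

(** A factor that is unambiguous for [d] and for [e] is so for [lcmn d e], hence
    is counted once; the others are counted at most [lcmn d e] times. *)
Lemma sum_residue_lcm (T : finType) (x : nat -> T) L d e :
  0 < d -> 0 < e ->
  \sum_(i < lcmn d e) #|residue_factors x L (lcmn d e) i| <=
  complexity x L + lcmn d e * (#|ambiguous x L d| + #|ambiguous x L e|).
Proof.
move=> d0 e0; set m := lcmn d e; have m0 : 0 < m by rewrite lcmn_gt0 d0.
rewrite sum_residue_factors.
pose A := ambiguous x L d :|: ambiguous x L e.
apply: (@leq_trans (\sum_(w in values (factor x L)) (1 + m * (w \in A)))).
  apply: leq_sum => w /valuesP[j ->]; case: (boolP (_ \in A)) => [_|].
    by rewrite muln1 ltnW // add1n ltnS (leq_trans (max_card _)) ?card_ord.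
  rewrite muln0 inE negb_or => /andP[nd ne]; rewrite addn0.
  apply/card_le1_eqP => i i'; rewrite [i \in _]inE [i' \in _]inE.
  move=> /valuesP[k ek] /valuesP[k' ek'].
  suff : k * m + i = k' * m + i' %[mod m].
    by rewrite !modnMDl !modn_small // => /esym/val_inj.
  apply/eqP; rewrite eqn_mod_lcm; apply/andP.
  by split; apply/eqP; apply: (@unambiguous_residue _ x L); rewrite -?ek -?ek'.
rewrite big_split /= sum1_card leq_add2l -big_distrr leq_mul2l.
apply/orP; right.
have -> : \sum_(w in values (factor x L)) (w \in A : nat) =
          \sum_(w in values (factor x L) | w \in A) 1.
  by rewrite [RHS]big_mkcondr; apply: eq_bigr => w _; case: (w \in A).
rewrite sum1dep_card; apply: (@leq_trans #|A|); last exact: leq_card_setU.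
by apply: subset_leq_card; apply/fintype.subsetP => w; rewrite !inE => /andP[].
Qed.

(** The counts of the [m] classes mod [m = lcmn d e] add up to at most
    [n * m + C] while every single one exceeds [n]; so none of them can exceed
    [n] by more than a bounded amount. *)
Lemma quasi_sturmian_block_lcm (T : finType) (x : nat -> T) d e :
  0 < d -> 0 < e ->
  quasi_sturmian (block x d 0) -> quasi_sturmian (block x e 0) ->
  quasi_sturmian (block x (lcmn d e) 0).
Proof.
move=> d0 e0 qd qe; have [Cd bd] := sum_residue_bound d0 qd.
have [Ce be] := sum_residue_bound e0 qe.
have nper := aperiodic_of_block (quasi_sturmian_aperiodic qd).
have m0 : 0 < lcmn d e by rewrite lcmn_gt0 d0.
pose m := lcmn d e; rewrite -/m in m0 *.
apply: (@quasi_sturmian_of_bound _ _ 1 (Cd + m * (Cd + Ce))) => // [|n].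
  exact: block_aperiodic.
rewrite muln1.
have mult k : k %| m -> exists q, n * m = q * k.
  by move=> /dvdnP[q ->]; exists (n * q); rewrite mulnA.
have ambig_bound k C : 0 < k -> k %| m ->
    (forall q, \sum_(i < k) #|residue_factors x (q * k) k i| <= q * k + C) ->
    complexity x (n * m) <= n * m + C /\ #|ambiguous x (n * m) k| <= C.
  move=> k0 /mult[q eq_q] bk; rewrite eq_q.
  have := leq_trans (card_ambiguous x (q * k) k0) (bk q).
  by have := complexity_gt (q * k) nper; lia.
have [cd ad] := ambig_bound d Cd d0 (dvdn_lcml d e) bd.
have [_ ae] := ambig_bound e Ce e0 (dvdn_lcmr d e) be.
have := sum_residue_lcm x (n * m) d0 e0; rewrite -/m.
rewrite (bigD1 (Ordinal m0)) //= -complexity_block.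
have : \sum_(i < m | i != Ordinal m0) n <=
       \sum_(i < m | i != Ordinal m0) #|residue_factors x (n * m) m i|.
  apply: leq_sum => i _; rewrite -complexity_block ltnW //.
  exact/complexity_gt/block_aperiodic.
rewrite sum_nat_const (_ : #|_| = m.-1); last first.
  by rewrite cardC1 card_ord.
have : m * (#|ambiguous x (n * m) d| + #|ambiguous x (n * m) e|) <=
       m * (Cd + Ce).
  by rewrite leq_mul2l leq_add ?orbT.
have : m.-1 * n + n = n * m by rewrite -mulSnr prednK // mulnC.
move=> card_m ambig_m others /leq_trans/(_ (leq_add cd ambig_m)).
move: others; set S := (X in _ <= X -> _) => others le_total.
rewrite -(leq_add2r S); apply: leq_trans le_total _.
rewrite -card_m; lia.
Qed.
End Combinatorics.

Section Expansions.
Local Open Scope classical_set_scope.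
Local Open Scope ring_scope.

(** * Digits of a real number *)

Definition shift_floor (R : realType) (B : nat) (xi : R) (n : nat) : int :=
  Num.floor (B%:R ^+ n * xi).

Lemma shift_floor_step (R : realType) (B : nat) (xi : R) n :
  (0 < B)%N ->
  0 <= shift_floor B xi n.+1 - B%:Z * shift_floor B xi n < B%:Z.
Proof.
move=> B0; rewrite subr_ge0 ltrBlDl /shift_floor.
have /andP[lo hi] := floor_itv (B%:R ^+ n * xi).
have B0R : 0 < B%:R :> R by rewrite ltr0n.
rewrite floor_ge_int floor_lt_int exprS -mulrA.
rewrite !intrD intrM /= ler_pM2l // lo /=.
rewrite -[X in _ + X]mulr1 -mulrDr ltr_pM2l //.
by rewrite intrD in hi.
Qed.

(** Uniqueness of the expansion: the [n]-th digit is the one read off the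
    integer parts of [B ^ n * xi] and [B ^ (n + 1) * xi]. The point is that the
    tail of the series after [n] terms is strictly below [B ^ - n], and this is
    where the infinitely many digits different from [B - 1] enter. *)
Lemma expansion_shift_floor (R : realType) (B : nat) (xi : R)
    (a : nat -> 'I_B) n :
  (2 <= B)%N -> is_expansion xi a ->
  shift_floor B xi n.+1 = B%:Z * shift_floor B xi n + (a n : nat)%:Z.
Proof.
move=> B2 [cvg_a inf_a].
have B0 : 0 < B%:R :> R by rewrite ltr0n; lia.
have Bn0 m : 0 < B%:R ^+ m :> R by rewrite exprn_gt0.
pose S := series (fun k : nat => (a k)%:R / B%:R ^+ k.+1 : R).
(* [U m] is the largest value that the first [m] digits permit; it decreases
   strictly at each digit other than [B - 1]. *)
pose U m := S m + (B%:R ^+ m)^-1.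
have U_step m : U m - U m.+1 = (B.-1 - a m)%:R / B%:R ^+ m.+1.
  rewrite /U /S seriesSr natrB; last by have := ltn_ord (a m); lia.
  have -> : B.-1%:R = B%:R - 1 :> R by rewrite -subn1 natrB //; lia.
  by rewrite exprS; field; rewrite !gt_eqF.
have S_nd : nondecreasing_seq S.
  apply/nondecreasing_seqP => m; rewrite /S seriesSr lerDl.
  by rewrite divr_ge0 // ltW.
have U_ni : nonincreasing_seq U.
  apply/nonincreasing_seqP => m; rewrite -subr_ge0 U_step.
  by rewrite divr_ge0 // ltW.
have cvg_U : U @ \oo --> xi - (Num.floor xi)%:~R.
  rewrite -[X in _ --> X]addr0; apply: cvgD => //.
  have -> : (fun m => (B%:R ^+ m)^-1) = geometric 1 (B%:R^-1) :> (nat -> R).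
    by apply/funext => m /=; rewrite mul1r exprVn.
  apply: cvg_geometric; rewrite ger0_norm ?invr_ge0 ?ltW //.
  by rewrite invf_lt1 // ltr1n.
have lo m : S m <= xi - (Num.floor xi)%:~R.
  rewrite -(cvg_lim (@Rhausdorff R) cvg_a).
  by apply: nondecreasing_cvgn_le => //; apply: cvgP cvg_a.
have le_U m : xi - (Num.floor xi)%:~R <= U m.
  rewrite -(cvg_lim (@Rhausdorff R) cvg_U).
  by apply: nonincreasing_cvgn_ge => //; apply: cvgP cvg_U.
have hi m : xi - (Num.floor xi)%:~R < U m.
  have [k le_mk ak] : exists2 k, (m <= k)%N & (a k : nat) <> B.-1.
    apply: contrapT => none; apply: inf_a.
    apply: (@sub_finite_set _ _ `I_m); last exact: finite_II.
    move=> k /= ak; rewrite ltnNge; apply/negP => le_mk.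
    by apply: none; exists k.
  apply: le_lt_trans (le_U k.+1) _; apply: lt_le_trans (U_ni _ _ le_mk).
  rewrite -subr_gt0 U_step divr_gt0 // ltr0n subn_gt0.
  by have := ltn_ord (a k); lia.
(* [w m] is the integer written by [floor xi] followed by [m] digits. *)
pose w := fix w m : int :=
  if m is m'.+1 then B%:Z * w m' + (a m' : nat)%:Z else Num.floor xi.
have wE m : (w m)%:~R = B%:R ^+ m * ((Num.floor xi)%:~R + S m) :> R.
  elim: m => [|m IH].
    by rewrite /S /series /= big_geq // expr0 mul1r addr0.
  rewrite /= intrD intrM IH /S seriesSr /= exprS.
  by field; rewrite !gt_eqF.
have shiftE m : shift_floor B xi m = w m.
  apply: floor_def; rewrite intrD wE ler_pM2l // -lerBrDl lo /=.
  rewrite -[X in _ + X](@mulfV _ (B%:R ^+ m)) ?gt_eqF // -mulrDr ltr_pM2l //.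
  by rewrite -addrA -ltrBlDl hi.
by rewrite !shiftE.
Qed.

(** The partial sums telescope: after [m] terms the remainder is the fractional
    part of [B ^ m * xi] divided by [B ^ m]. Were all digits from [N] on equal
    to [B - 1], the distance of [B ^ n * xi] to the next integer would be
    multiplied by [B] at each step from [N] on, which is impossible as it is
    positive and at most [1]. *)
Lemma expansion_of_shift_floor (R : realType) (B : nat) (xi : R)
    (a : nat -> 'I_B) :
  (2 <= B)%N ->
  (forall n, shift_floor B xi n.+1 =
             B%:Z * shift_floor B xi n + (a n : nat)%:Z) ->
  is_expansion xi a.
Proof.
move=> B2 aE.
have B0 : 0 < B%:R :> R by rewrite ltr0n; lia.
have Bn0 m : 0 < B%:R ^+ m :> R by rewrite exprn_gt0.
(* The fractional part of [B ^ m * xi]. *)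
pose f m := B%:R ^+ m * xi - (shift_floor B xi m)%:~R.
have f01 m : 0 <= f m < 1.
  have /andP[lo hi] := floor_itv (B%:R ^+ m * xi).
  by rewrite /f subr_ge0 lo ltrBlDl /=; rewrite intrD in hi.
have fS m : f m.+1 = B%:R * f m - (a m)%:R.
  by rewrite /f aE intrD intrM /= exprS; ring.
have geo : geometric 1 (B%:R^-1) @ \oo --> (0 : R).
  apply: cvg_geometric; rewrite ger0_norm ?invr_ge0 ?ltW //.
  by rewrite invf_lt1 // ltr1n.
split.
  have SE m : series (fun k : nat => (a k)%:R / B%:R ^+ k.+1 : R) m =
      xi - (Num.floor xi)%:~R - f m / B%:R ^+ m.
    elim: m => [|m IH].
      by rewrite /series /= big_geq // /f /shift_floor expr0 mul1r divr1 subrr.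
    by rewrite seriesSr IH fS exprS; field; rewrite !gt_eqF.
  rewrite (funext SE) -[X in _ --> X]subr0; apply: cvgB; first exact: cvg_cst.
  apply: (@squeeze_cvgr _ _ _ _ (fun=> 0) (geometric 1 (B%:R^-1))) => //.
    apply: nearW => m; rewrite /geometric /=; have /andP[f0 f1] := f01 m.
    rewrite mul1r exprVn divr_ge0 ?(ltW (Bn0 _)) //=.
    by rewrite ler_piMl ?invr_ge0 ?(ltW (Bn0 _)) // ltW.
  exact: cvg_cst.
move=> fin.
have [N aN] : exists N, forall k, (N <= k)%N -> (a k : nat) = B.-1.
  have /finite_seqP[s Es] := fin; exists (\max_(i <- s) i).+1 => k lt_k.
  apply: contrapT => ak; have : [set` s] k by rewrite -Es.
  move=> /= k_s; have := leq_bigmax_seq (P := xpredT) (F := id) k k_s isT.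
  by rewrite leqNgt lt_k.
have gap m : 1 - f N = (1 - f (N + m)%N) / B%:R ^+ m.
  elim: m => [|m IH]; first by rewrite addn0 divr1.
  rewrite addnS fS aN ?leq_addr // -subn1 natrB; last by lia.
  by rewrite IH exprS; field; rewrite !gt_eqF.
have : 1 - f N <= 0.
  rewrite -(cvg_lim (@Rhausdorff R) geo); apply: limr_ge; first exact: cvgP geo.
  apply: nearW => m /=; rewrite (gap m) mul1r exprVn.
  rewrite ler_piMl ?invr_ge0 ?(ltW (Bn0 _)) //.
  by have := f01 (N + m)%N; lra.
by have /andP[_] := f01 N; rewrite -subr_gt0 ltNge => /negPf ->.
Qed.

Lemma expansion_exists (R : realType) (B : nat) (xi : R) :
  (2 <= B)%N -> exists a : nat -> 'I_B, is_expansion xi a.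
Proof.
move=> B2; have step n := shift_floor_step xi n (ltnW B2).
have lt_dig n :
    (`|(shift_floor B xi n.+1 - B%:Z * shift_floor B xi n)%R| < B)%N.
  by have := step n; lia.
exists (fun n => Ordinal (lt_dig n)).
apply: expansion_of_shift_floor => // n /=.
by have := step n; lia.
Qed.

(** With [N n] the integer part of [B ^ n * xi], the difference
    [N (m + d) - B ^ d * N m] is the number whose base-[B] digits are the [d]
    digits after position [m]; Euclidean division by [B] makes the digits
    unique. *)
Lemma eq_block_digits (B : nat) (N : nat -> int) d m m' :
  (forall n, 0 <= N n.+1 - B%:Z * N n < B%:Z) ->
  (N (m + d)%N - B%:Z ^+ d * N m = N (m' + d)%N - B%:Z ^+ d * N m') <->
  (forall i, (i < d)%N ->
    N (m + i).+1 - B%:Z * N (m + i)%N = N (m' + i).+1 - B%:Z * N (m' + i)%N).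
Proof.
move=> step; elim: d => [|d IH].
  by rewrite !addn0 !expr0 !mul1r !subrr; split.
have horner k : N (k + d.+1)%N - B%:Z ^+ d.+1 * N k =
    B%:Z * (N (k + d)%N - B%:Z ^+ d * N k) +
    (N (k + d).+1 - B%:Z * N (k + d)%N).
  by rewrite addnS exprS; ring.
rewrite !horner; split=> [e|e].
  have euclid (q q' r r' : int) : 0 <= r < B%:Z -> 0 <= r' < B%:Z ->
      B%:Z * q + r = B%:Z * q' + r' -> q = q' /\ r = r'.
    move=> r_bnd r'_bnd eq_qr.
    have le_mul (u v : int) : u < v -> B%:Z * (u + 1) <= B%:Z * v.
      by move=> lt_uv; rewrite ler_wpM2l //; lia.
    have [/le_mul|/le_mul|eq_q] := ltgtP q q'; [lia | lia |].
    by split=> //; move: eq_qr; rewrite eq_q; lia.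
  have [/IH eq_lo eq_d] := euclid _ _ _ _ (step _) (step _) e.
  by move=> i; rewrite ltnS leq_eqVlt => /predU1P[->|/eq_lo].
by rewrite (e d) //; congr (_ * _ + _); apply/IH => i /ltnW; apply: e.
Qed.

Lemma shift_floorX (R : realType) (b d : nat) (xi : R) n :
  shift_floor (b ^ d) xi n = shift_floor b xi (n * d).
Proof. by rewrite /shift_floor natrX -exprM mulnC. Qed.

(** The base-[b ^ d] expansion is the base-[b] expansion read in blocks: two
    digits in base [b ^ d] are equal exactly when the blocks of [d] digits in
    base [b] at the same places are. *)
Lemma eq_expansion_block (R : realType) (b d : nat) (xi : R)
    (c : nat -> 'I_b) (x : nat -> 'I_(b ^ d)) :
  (2 <= b)%N -> (0 < d)%N -> is_expansion xi c -> is_expansion xi x ->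
  forall j j', x j = x j' <-> block c d 0 j = block c d 0 j'.
Proof.
move=> b2 d0 exp_c exp_x j j'.
have digit_c n : shift_floor b xi n.+1 - b%:Z * shift_floor b xi n =
    (c n : nat)%:Z.
  by rewrite (expansion_shift_floor n b2 exp_c) addrAC subrr add0r.
have b_gt0 : (0 < b)%N by lia.
have bd2 : (2 <= b ^ d)%N by rewrite (leq_trans b2) // -{1}(expn1 b) leq_pexp2l.
have digit_x n : shift_floor b xi (n * d + d) -
    b%:Z ^+ d * shift_floor b xi (n * d) = (x n : nat)%:Z.
  rewrite -mulSnr -!shift_floorX (expansion_shift_floor n bd2 exp_x).
  by rewrite -natz natrX natz addrAC subrr add0r.
have := eq_block_digits d (j * d) (j' * d)
  (fun n => shift_floor_step xi n b_gt0).
rewrite !digit_x => -[to_c to_x]; split=> [eq_x|/eq_factor eq_c].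
  apply/eq_factor => i lt_id; apply: val_inj; rewrite !addn0.
  have : (x j : nat)%:Z = (x j' : nat)%:Z by rewrite eq_x.
  by move/to_c/(_ i lt_id); rewrite !digit_c => -[].
apply: val_inj; suff [] : (x j : nat)%:Z = (x j' : nat)%:Z by [].
apply: to_x => i lt_id; rewrite !digit_c.
by have := eq_c i lt_id; rewrite !addn0 => ->.
Qed.

Lemma has_quasi_sturmian_expansion_block (R : realType) (b d : nat) (xi : R)
    (c : nat -> 'I_b) :
  (2 <= b)%N -> (0 < d)%N -> is_expansion xi c ->
  has_quasi_sturmian_expansion (b ^ d) xi <-> quasi_sturmian (block c d 0).
Proof.
move=> b2 d0 exp_c; split=> [[x exp_x qs]|qs].
  apply: quasi_sturmian_ext qs => j j'.
  exact: eq_expansion_block exp_c exp_x j j'.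
have bd2 : (2 <= b ^ d)%N.
  by rewrite (leq_trans b2) // -{1}(expn1 b) leq_pexp2l //; lia.
have [x exp_x] := expansion_exists xi bd2; exists x => //.
apply: quasi_sturmian_ext qs => j j'; apply: iff_sym.
exact: eq_expansion_block exp_c exp_x j j'.
Qed.
End Expansions.

Theorem theorem1p5 (R : realType) (b rho sigma : nat)
    (hb : (2 <= b)%N) (hrho : (0 < rho)%N) (hsigma : (0 < sigma)%N) :
  ((sigma %| rho)%N ->
     forall xi : R, has_quasi_sturmian_expansion (b ^ rho)%N xi ->
       has_quasi_sturmian_expansion (b ^ sigma)%N xi) /\
  (forall xi : R, has_quasi_sturmian_expansion (b ^ rho)%N xi ->
     has_quasi_sturmian_expansion (b ^ sigma)%N xi ->
     has_quasi_sturmian_expansion (b ^ lcmn rho sigma)%N xi).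
Proof.
split=> [/dvdnP[q rho_eq] xi|xi qs_rho qs_sigma].
  have q0 : (0 < q)%N by move: hrho; rewrite rho_eq muln_gt0 => /andP[].
  have B2 : (2 <= b ^ sigma)%N.
    by rewrite (leq_trans hb) // -{1}(expn1 b) leq_pexp2l // ltnW.
  have [c exp_c] := expansion_exists xi B2.
  rewrite rho_eq mulnC expnM.
  move=> /(has_quasi_sturmian_expansion_block B2 q0 exp_c).
  by exists c => //; apply: quasi_sturmian_unblock q0 _.
have [c exp_c] := expansion_exists xi hb.
have lcm0 : (0 < lcmn rho sigma)%N by rewrite lcmn_gt0 hrho.
apply/(has_quasi_sturmian_expansion_block hb lcm0 exp_c).
by apply: quasi_sturmian_block_lcm => //;
  apply/(has_quasi_sturmian_expansion_block hb _ exp_c).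
Qed.
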